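(* Let $(X,\tau,\mathfrak a)$ be an aura topological space. The following are equivalent: (i) $(X,\tau,\mathfrak a)$ is aura-$T_0$; (ii) $\preccurlyeq_{\mathfrak a}$ is antisymmetric; (iii) every strongly connected component is a singleton; (iv) the map $x\mapsto K_{\mathfrak a}(\{x\})$ from $X$ to $\mathcal P(X)$ is injective.
   Context: $X$ is a nonempty set. An aura topological space is a triple $(X,\tau,\mathfrak a)$ where $(X,\tau)$ is a topological space and $\mathfrak a:X\to\tau$ (the scope function) satisfies $x\in\mathfrak a(x)$ for every $x\in X$. A set $U\subseteq X$ is $\mathfrak a$-open (aura-open) if $\{x\in U:\mathfrak a(x)\subseteq U\}=U$; the family of all $\mathfrak a$-open sets is denoted $\tau_{\mathfrak a}$ and is known to be a topology on $X$. The space is aura-$T_i$ if $(X,\tau_{\mathfrak a})$ satisfies the separation axiom $T_i$. The scope relation is $xR_{\mathfrak a}y\iff y\in\mathfrak a(x)$, and $\preccurlyeq_{\mathfrak a}$ is its reflexive-transitive closure. Strongly connected components are the equivalence classes of the relation: $x\preccurlyeq_{\mathfrak a}y$ and $y\preccurlyeq_{\mathfrak a}x$. The canonical hull is $K_{\mathfrak a}(A)=\bigcap\{U\in\tau_{\mathfrak a}:A\subseteq U\}$. *)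

(* Defs.v *)
From HB Require Import structures.
From mathcomp Require Import all_boot all_order all_algebra.
From mathcomp Require Import all_classical.
From mathcomp Require Import topology_structure separation_axioms.
From Stdlib Require Relation_Definitions Relation_Operators.

Set Implicit Arguments.
Unset Strict Implicit.
Unset Printing Implicit Defensive.

Local Open Scope classical_set_scope.

Record scope_function (X : topologicalType) := ScopeFunction {
  scope_fun :> X -> set X;
  scope_open : forall x, open (scope_fun x);
  scope_mem : forall x, scope_fun x x }.

Definition aura_open (X : topologicalType) (a : scope_function X) :
    set_system X :=
  [set U | [set x | U x /\ a x `<=` U] = U].

(* The carrier of X equipped with the topology of a-open sets instead of its
   original one; the argument a only serves to select the instance. *)
Definition aura_space (X : topologicalType) (a : scope_function X) : Type := X.

Section AuraTopology.
Context (X : topologicalType) (a : scope_function X).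

Lemma aura_openP (U : set X) :
  aura_open a U <-> forall x, U x -> a x `<=` U.
Proof.
split=> [UE x Ux|sub]; first by move: Ux; rewrite -{1}UE => -[].
by apply/seteqP; split=> x /= => [[]|Ux] //; split=> //; exact: sub.
Qed.

Lemma aura_openT : aura_open a setT.
Proof. by apply/aura_openP. Qed.

Lemma aura_openI : setI_closed (aura_open a).
Proof.
move=> U V /aura_openP oU /aura_openP oV; apply/aura_openP => x [Ux Vx] y axy.
by split; [exact: oU axy | exact: oV axy].
Qed.

Lemma aura_open_bigU (I : Type) (f : I -> set X) :
  (forall i, aura_open a (f i)) -> aura_open a (\bigcup_i f i).
Proof.
move=> of_; apply/aura_openP => x [i _ fix_] y axy; exists i => //.
by move/aura_openP: (of_ i) => /(_ x fix_); apply.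
Qed.

HB.instance Definition _ := Choice.on (aura_space a).
HB.instance Definition _ := isOpenTopological.Build (aura_space a)
  aura_openT aura_openI aura_open_bigU.

Lemma open_aura_spaceE : @open (aura_space a) = aura_open a.
Proof. by []. Qed.

End AuraTopology.

Section AuraNotions.
Context (X : topologicalType) (a : scope_function X).

Definition aura_T0 : Prop := kolmogorov_space (aura_space a).

Definition scope_rel (x y : X) : Prop := a x y.

Definition scope_preorder : X -> X -> Prop :=
  Relation_Operators.clos_refl_trans X scope_rel.

Definition mutually_reachable (x y : X) : Prop :=
  scope_preorder x y /\ scope_preorder y x.

Definition strongly_connected_component (C : set X) : Prop :=
  exists x, C = [set y | mutually_reachable x y].

(* [smallest F A] is by definition the intersection of the members of F that
   contain A. *)
Definition canonical_hull (A : set X) : set X := smallest (aura_open a) A.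

End AuraNotions.

(* Main.v *)
Require Import Defs.
From mathcomp Require Import all_boot all_order all_algebra.
From mathcomp Require Import all_classical.
From mathcomp Require Import topology_structure separation_axioms.
From Stdlib Require Relation_Definitions.
From Stdlib Require Import Relation_Operators.

Local Open Scope classical_set_scope.

(** A set is aura-open exactly when it is closed under the scope relation, hence
    exactly when it is an up-set of the scope preorder: the aura topology is the
    Alexandrov topology of that preorder. So [x] has a least aura-neighbourhood,
    the set of points reachable from [x], and this set is also the canonical
    hull of [{x}] ([canonical_hull1E], [nbhs_aura_spaceE]). Consequently two
    points have the same hull, and equivalently the same aura-neighbourhoods,
    precisely when each is reachable from the other ([canonical_hull1_eqP]);
    each of the four conditions says that this never happens for distinct
    points. *)

Lemma aura_open_preorder {X : topologicalType} {a : scope_function X}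
    {U : set X} {x y : X} :
  aura_open a U -> scope_preorder a x y -> U x -> U y.
Proof.
move=> /aura_openP oU; elim=> // [u v auv Uu|u v w _ IHuv _ IHvw /IHuv/IHvw //].
exact: oU auv.
Qed.

Lemma aura_open_reachable {X : topologicalType} (a : scope_function X) (x : X) :
  aura_open a (scope_preorder a x).
Proof.
apply/aura_openP => y xy z ayz.
by apply: rt_trans xy _; exact: rt_step.
Qed.

(** Aura-open sets are up-sets, and the points reachable from [x] form an
    aura-open set, which is therefore the least one containing [x]. *)
Lemma canonical_hull1E {X : topologicalType} (a : scope_function X) (x : X) :
  canonical_hull a [set x] = scope_preorder a x.
Proof.
apply/seteqP; split=> [y hy|y xy U [oU xU]].
  apply: (hy (scope_preorder a x)); split; first exact: aura_open_reachable.
  by move=> z ->; exact: rt_refl.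
exact: aura_open_preorder oU xy (xU x erefl).
Qed.

Lemma nbhs_aura_spaceE {X : topologicalType} (a : scope_function X) (x : X)
    (A : set X) :
  nbhs (x : aura_space a) A <-> scope_preorder a x `<=` A.
Proof.
rewrite nbhsE; split=> [[U [oU Ux] UA] y xy|xA].
  by apply: UA; exact: aura_open_preorder oU xy Ux.
exists (scope_preorder a x) => //; split; last exact: rt_refl.
exact: aura_open_reachable.
Qed.

(** A preorder makes two points equivalent exactly when they generate the same
    principal up-set. *)
Lemma canonical_hull1_eqP {X : topologicalType} (a : scope_function X)
    (x y : X) :
  canonical_hull a [set x] = canonical_hull a [set y] <->
  mutually_reachable a x y.
Proof.
rewrite !canonical_hull1E; split=> [xyE|[xy yx]].
  by split; [rewrite xyE | rewrite -xyE]; exact: rt_refl.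
by apply/seteqP; split=> z; [exact: rt_trans yx | exact: rt_trans xy].
Qed.

Theorem corollary6p3 (X : topologicalType) (X0 : [set: X] !=set0)
    (a : scope_function X) :
  [<-> aura_T0 a;
       Relation_Definitions.antisymmetric X (scope_preorder a);
       forall C : set X, strongly_connected_component a C ->
         exists x : X, C = [set x];
       injective (fun x : X => canonical_hull a [set x])].
Proof.
tfae.
- move=> T0 x y xy yx; apply: contrapT => /eqP /T0 [A].
  by rewrite !inE => -[] [/nbhs_aura_spaceE sA]; apply; exact: sA.
- move=> anti C [x ->]; exists x; apply/seteqP; split=> y /=.
    by move=> [xy yx]; exact: anti.
  by move=> ->; split; exact: rt_refl.
- move=> single x y /canonical_hull1_eqP xy.
  have [z Cz] := single _ (ex_intro _ x erefl).
  have -> : x = z.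
    suff: [set z] x by [].
    by rewrite -Cz; split; exact: rt_refl.
  by apply/esym; suff: [set z] y by []; rewrite -Cz.
- move=> inj x y /eqP xDy.
  (* One of the two least neighbourhoods misses the other point. *)
  have [xy|nxy] := pselect (scope_preorder a x y); last first.
    by exists (scope_preorder a x); left; rewrite !inE; split=> //;
      apply/nbhs_aura_spaceE.
  exists (scope_preorder a y); right; rewrite !inE; split.
    exact/nbhs_aura_spaceE.
  by move=> yx; apply: xDy; apply: inj; apply/canonical_hull1_eqP; split.
Qed.
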